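(* Let $S$ be a $\pi$-regular ordered semigroup. Then $S$ is right $\pi$-inverse if and only if for any two ordered idempotents $e,f\in E_\leq(S)$, $e\,\mathcal{L}^*\,f$ implies $e\,\mathcal{R}^*\,f$.
   Context: An ordered semigroup $(S,\cdot,\leq)$ is a (nonempty) semigroup with a partial order such that $a\leq b$ implies $xa\leq xb$ and $ax\leq bx$ for all $a,b,x\in S$. $\mathbb{N}$ denotes the positive integers. For $A\subseteq S$, $(A]=\{x\in S: x\leq a \text{ for some } a\in A\}$. $S$ is $\pi$-regular if for every $a\in S$ there is $m\in\mathbb{N}$ with $a^m\in(a^mSa^m]$. $Reg_\leq(S)=\{a\in S: a\in(aSa]\}$. $E_\leq(S)=\{e\in S: e\leq e^2\}$ is the set of ordered idempotents. $L(a)=(\{a\}\cup Sa]$, $R(a)=(\{a\}\cup aS]$; $a\,\mathcal{L}\,b$ iff $L(a)=L(b)$, and $a\,\mathcal{R}\,b$ iff $R(a)=R(b)$. For $S$ $\pi$-regular, $a\,\mathcal{L}^*\,b$ iff $a^m\,\mathcal{L}\,b^n$, and $a\,\mathcal{R}^*\,b$ iff $a^m\,\mathcal{R}\,b^n$, where $m,n$ are the smallest positive integers such that $a^m,b^n\in Reg_\leq(S)$. A $\pi$-regular ordered semigroup $S$ is right $\pi$-inverse if for every $a\in S$ there is $m\in\mathbb{N}$ such that $(Sa^m]$ is generated by an $\mathcal{R}$-unique ordered idempotent, i.e. there is $e\in E_\leq(S)$ with $(Sa^m]=(Se]$, and every $f\in E_\leq(S)$ with $(Sa^m]=(Sf]$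 satisfies $e\,\mathcal{R}\,f$. *)

(* Defs.v *)
From HB Require Import structures.
From mathcomp Require Import all_boot all_order.
From mathcomp Require Import boolp classical_sets.

Set Implicit Arguments.
Unset Strict Implicit.
Unset Printing Implicit Defensive.

Local Open Scope classical_set_scope.
Local Open Scope group_scope.
Local Open Scope order_scope.

HB.mixin Record Semigroup_POrder_isOrdered (d : Order.disp_t) S
    of Semigroup S & Order.POrder d S := {
  osg_inhabited : inhabited S ;
  le_mul2l : forall x a b : S, a <= b -> x * a <= x * b ;
  le_mul2r : forall x a b : S, a <= b -> a * x <= b * x
}.

#[short(type="orderedSemigroupType")]
HB.structure Definition OrderedSemigroup (d : Order.disp_t) :=
  { S of Semigroup S & Order.POrder d S & Semigroup_POrder_isOrdered d S }.

Section OrderedSemigroupDefs.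
Variables (d : Order.disp_t) (S : orderedSemigroupType d).
Implicit Types (a b e f : S) (m n : nat).

(* [a ^ m] for [0 < m]. There is no unit, so [spow a 0] is the junk value [a];
   every use below guards the exponent by [0 < m]. *)
Definition spow a m : S := iterop m (fun x y : S => x * y) a a.

(* [down A] is the set written (A]. *)
Definition SetSa a : set S := [set x * a | x in [set: S]].
Definition SetaS a : set S := [set a * x | x in [set: S]].
Definition SetaSa a : set S := [set a * x * a | x in [set: S]].

Definition Reg_le : set S := [set a | down (SetaSa a) a].

Definition E_le : set S := [set e | e <= e * e].

Definition pi_regular : Prop :=
  forall a, exists m, (0 < m)%N /\ down (SetaSa (spow a m)) (spow a m).

Definition Lideal a : set S := down ([set a] `|` SetSa a).
Definition Rideal a : set S := down ([set a] `|` SetaS a).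

Definition greenL a b : Prop := Lideal a = Lideal b.
Definition greenR a b : Prop := Rideal a = Rideal b.

Definition least_reg_exp a m : Prop :=
  [/\ (0 < m)%N, Reg_le (spow a m)
    & forall k, (0 < k)%N -> Reg_le (spow a k) -> (m <= k)%N].

(* In a pi-regular ordered semigroup the exponents [m] and [n] exist and are
   unique, so the existential merely names them. *)
Definition greenLstar a b : Prop :=
  exists m n, [/\ least_reg_exp a m, least_reg_exp b n
                & greenL (spow a m) (spow b n)].
Definition greenRstar a b : Prop :=
  exists m n, [/\ least_reg_exp a m, least_reg_exp b n
                & greenR (spow a m) (spow b n)].

Definition right_pi_inverse : Prop :=
  pi_regular /\
  forall a, exists m, (0 < m)%N /\
    exists e, [/\ E_le e, down (SetSa (spow a m)) = down (SetSa e)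
      & forall f, E_le f -> down (SetSa (spow a m)) = down (SetSa f) ->
          greenR e f].

End OrderedSemigroupDefs.

Arguments pi_regular {d} S.
Arguments right_pi_inverse {d} S.
Arguments E_le {d} S.
Arguments Reg_le {d} S.

(* Main.v *)
(** An ordered idempotent [e] satisfies [e <= e * e <= e * e * e], so it is
    regular with least exponent 1 and the starred relations between ordered
    idempotents are the plain Green relations; moreover [L(e) = (Se] = (Se^m]].
    Conversely, [a^m <= a^m x a^m] makes [x a^m] an ordered idempotent that
    generates [(Sa^m]].  Both implications compare such generators. *)
Require Import Defs.
From HB Require Import structures.
From mathcomp Require Import all_boot all_order.
From mathcomp Require Import boolp classical_sets.

Section OrderedIdempotents.
Local Open Scope classical_set_scope.
Local Open Scope group_scope.
Local Open Scope order_scope.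
Import Order.POrderTheory.
Context {d : Order.disp_t} {S : orderedSemigroupType d}.
Implicit Types (a b c e f x y : S) (A B : set S) (m n : nat).

Lemma spowSS a n : spow a n.+2 = a * spow a n.+1.
Proof. by []. Qed.

Lemma subset_down A B : A `<=` down B -> down A `<=` down B.
Proof.
move=> AB x [y [/AB[z [Bz le_yz]] le_xy]].
by exists z; split=> //; apply: le_trans le_yz.
Qed.

Lemma sub_down A : A `<=` down A.
Proof. by move=> x Ax; exists x. Qed.

(** Left multiplication by [y] turns the hypothesis into [y * a <= (y * c) * b]. Every inclusion
    between sets [(Sa]] and [(Sb]] below thus reduces to a single inequality. *)
Lemma down_SetSaS a b c : a <= c * b -> down (SetSa a) `<=` down (SetSa b).
Proof.
move=> le_acb; apply: subset_down => _ [y _ <-].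
exists (y * c * b); split; first by exists (y * c).
by rewrite -mulgA; apply: le_mul2l.
Qed.

Lemma Lideal_E_le e : E_le S e -> Lideal e = down (SetSa e).
Proof.
move=> Ee; apply/seteqP; split; apply: subset_down => x.
- case=> [->|Sx]; last exact: sub_down.
  by exists (e * e); split; first by exists e.
- by move=> Sx; apply: sub_down; right.
Qed.

Lemma E_le_le_mul_spow e n : E_le S e -> e <= e * spow e n.+1.
Proof.
move=> Ee; elim: n => [//|n IHn]; rewrite spowSS.
by apply: (le_trans Ee); apply: le_mul2l.
Qed.

Lemma spow_le_mul e n : E_le S e -> exists c, spow e n.+1 <= c * e.
Proof.
(* At exponent 1 the factor [c = e] stands in for a unit, since [e <= e * e]. *)
move=> Ee; elim: n => [|n [c le_c]]; first by exists e.
by exists (e * c); rewrite spowSS -mulgA; apply: le_mul2l.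
Qed.

Lemma down_SetSa_spow e m :
  E_le S e -> (0 < m)%N -> down (SetSa (spow e m)) = down (SetSa e).
Proof.
case: m => // m Ee _; apply/seteqP; split.
- by have [c] := spow_le_mul e m Ee; apply: down_SetSaS.
- by apply: down_SetSaS (E_le_le_mul_spow e m Ee).
Qed.

Lemma E_le_Reg_le e : E_le S e -> Reg_le S e.
Proof.
move=> Ee; exists (e * e * e); split; first by exists e.
by apply: (le_trans Ee); apply: le_mul2r.
Qed.

Lemma least_reg_exp_E_le e m : E_le S e -> least_reg_exp e m <-> m = 1%N.
Proof.
move=> Ee; split=> [[m_gt0 _ min_m]|->].
- by apply/eqP; rewrite eqn_leq m_gt0 andbT; apply: min_m => //;
    apply: E_le_Reg_le.
- by split=> //; apply: E_le_Reg_le.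
Qed.

Lemma greenLstar_E_le e f :
  E_le S e -> E_le S f -> greenLstar e f <-> greenL e f.
Proof.
move=> Ee Ef; split=> [[m [n [em fn]]]|Lef].
- by move: em fn => /(least_reg_exp_E_le _ _ Ee)-> /(least_reg_exp_E_le _ _ Ef)->.
- by exists 1%N, 1%N; split=> //; apply/least_reg_exp_E_le.
Qed.

Lemma greenRstar_E_le e f :
  E_le S e -> E_le S f -> greenRstar e f <-> greenR e f.
Proof.
move=> Ee Ef; split=> [[m [n [em fn]]]|Ref].
- by move: em fn => /(least_reg_exp_E_le _ _ Ee)-> /(least_reg_exp_E_le _ _ Ef)->.
- by exists 1%N, 1%N; split=> //; apply/least_reg_exp_E_le.
Qed.

Lemma greenL_E_le e f :
  E_le S e -> E_le S f -> greenL e f <-> down (SetSa e) = down (SetSa f).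
Proof. by move=> Ee Ef; rewrite /greenL !Lideal_E_le. Qed.

Lemma Reg_le_generator a :
  Reg_le S a -> exists2 e, E_le S e & down (SetSa a) = down (SetSa e).
Proof.
case=> _ [[x _ <-] le_a]; exists (x * a).
- by rewrite /E_le /= -mulgA; apply: le_mul2l; rewrite mulgA.
(* One inclusion comes from [x * a <= x * a], the other from [a <= a * (x * a)], which is regularity
   of [a] reassociated. *)
- apply/seteqP; split; last exact: (down_SetSaS _ _ x).
  by apply: (down_SetSaS _ _ a); rewrite mulgA.
Qed.

End OrderedIdempotents.

Theorem theorem3p4 (d : Order.disp_t) (S : orderedSemigroupType d)
    (hS : pi_regular S) :
  right_pi_inverse S <->
  (forall e f : S, E_le S e -> E_le S f -> greenLstar e f -> greenRstar e f).
Proof.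
split=> [[_ inv] e f Ee Ef|LR].
- move=> /(greenLstar_E_le _ _ Ee Ef)/(greenL_E_le _ _ Ee Ef) Sef.
  apply/(greenRstar_E_le _ _ Ee Ef).
  (* The exponent [m] is not under control, but [(Se^m] = (Se] = (Sf]] whatever its value. Hence [e]
     and [f] both compete with [g], and [greenR] links them through [g]. *)
  have [m [m_gt0 [g [_ _ uniq_g]]]] := inv e.
  have Sem := down_SetSa_spow e m Ee m_gt0.
  have Rge : greenR g e by apply: uniq_g.
  have Rgf : greenR g f by apply: uniq_g; rewrite // Sem.
  by rewrite /greenR -Rge.
- split=> // a; have [m [m_gt0 reg_am]] := hS a.
  exists m; split=> //; have [e Ee Se] := Reg_le_generator _ reg_am.
  (* Any competitor [f] satisfies [(Se] = (Sf]], which for ordered idempotents is [greenL e f], so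
     [LR] applies. *)
  exists e; split=> // f Ef Sf.
  apply/(greenRstar_E_le _ _ Ee Ef)/(LR _ _ Ee Ef).
  by apply/(greenLstar_E_le _ _ Ee Ef)/(greenL_E_le _ _ Ee Ef); rewrite -Se.
Qed.
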